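(* Let $(X,\tau)$ be a topological space, and let $\mathcal{B}$ be a regular family of open covers of $X$. Assume that $\mathsf{U}_{\mathrm{fin}}(\mathrm{O}(X),\mathcal{B})$ holds. Let $\mathcal{U}_1\supseteq\mathcal{U}_2\supseteq\cdots$ be countable point-infinite open covers of $X$, each having no finite subcover. Let $k\in\mathbb{N}$, and let $\chi_1\colon\tau\to\{1,\dots,k\}$ and $\chi_2\colon[\tau]^2\to\{1,\dots,k\}$ be arbitrary finite colorings of the sets $\tau$ and $[\tau]^2$. Then there are nonempty, pairwise disjoint, finite sets $\mathcal{F}_1\subseteq\mathcal{U}_1,\ \mathcal{F}_2\subseteq\mathcal{U}_2,\dots$ such that the sets $V_n:=\bigcup\mathcal{F}_n$, for $n\in\mathbb{N}$, have the following properties: (1) The family $\{V_1,V_2,\dots\}$ is in $\mathcal{B}$. (2) For all nonempty finite sets $F<H$ of natural numbers, the sets $\bigcup_{n\in F}V_n$ and $\bigcup_{n\in H}V_n$ are distinct. (3) All sets $\bigcup_{n\in F}V_n$, for nonempty finite sets $F\subseteq\mathbb{N}$, have the same color (under $\chi_1$). (4) All sets $\{\bigcup_{n\in F}V_n,\ \bigcup_{n\in H}V_n\}$, for nonempty finite sets $F<H$ of natural numbers, have the same color (under $\chi_2$). Moreover, if $\mathcal{U}_1=\{U_1,U_2,\dots\}$ is enumerated without repetitions, the sets $\mathcal{F}_n$ may be chosen so that, in addition, the sets $F_n:=\{m\in\mathbb{N}: U_m\in\mathcal{F}_n\}$ satisfy $F_1<F_2<\cdots$.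
   Context: $\mathrm{O}(X)$ is the family of countable open covers of $X$. For families $\mathcal{A},\mathcal{B}$ of covers of $X$, $\mathsf{U}_{\mathrm{fin}}(\mathcal{A},\mathcal{B})$ is the property that, for all covers $\mathcal{U}_1,\mathcal{U}_2,\dots\in\mathcal{A}$ with no finite subcover, there are finite sets $\mathcal{F}_1\subseteq\mathcal{U}_1,\mathcal{F}_2\subseteq\mathcal{U}_2,\dots$ such that $\{\bigcup\mathcal{F}_1,\bigcup\mathcal{F}_2,\dots\}\in\mathcal{B}$. A family $\mathcal{B}$ of open covers of a topological space $(X,\tau)$ is regular if: (i) whenever $\mathcal{U}\cup\mathcal{V}\in\mathcal{B}$, we have $\mathcal{U}\in\mathcal{B}$ or $\mathcal{V}\in\mathcal{B}$; and (ii) for each cover $\mathcal{U}\in\mathcal{B}$ and each finite-to-one function $f\colon\mathcal{U}\to\tau\setminus\{X\}$ with $U\subseteq f(U)$ for all $U\in\mathcal{U}$, the image of $f$ is in $\mathcal{B}$. A cover of $X$ is point-infinite if every point of $X$ is contained in infinitely many members of the cover. For a set $T$, $[T]^2$ is the set of all 2-element subsets of $T$. For nonempty finite sets $F,H\subseteq\mathbb{N}$, $F<H$ means that every element of $F$ is smaller than every element of $H$. The common color in (3) and the common color in (4) need not be equal. *)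

(* Defs.v *)
From mathcomp Require Import all_boot all_order.
From mathcomp Require Import all_classical topology.

Set Implicit Arguments.
Unset Strict Implicit.
Unset Printing Implicit Defensive.

Local Open Scope classical_set_scope.
Local Open Scope card_scope.

(* Sequences indexed by the positive integers are indexed by [nat] from 0. *)

Definition is_cover (X : Type) (U : set (set X)) : Prop :=
  cover U id = [set: X].

Definition open_cover (X : topologicalType) (U : set (set X)) : Prop :=
  U `<=` open /\ is_cover U.

Definition countable_open_covers (X : topologicalType) : set (set (set X)) :=
  [set U | countable U /\ open_cover U].
Arguments countable_open_covers X : clear implicits.

Definition has_finite_subcover (X : Type) (U : set (set X)) : Prop :=
  exists G : set (set X), [/\ finite_set G, G `<=` U & is_cover G].

Definition point_infinite (X : Type) (U : set (set X)) : Prop :=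
  forall x : X, infinite_set [set A | U A /\ A x].

Definition Ufin (X : Type) (A B : set (set (set X))) : Prop :=
  forall U : nat -> set (set X),
    (forall n, A (U n)) ->
    (forall n, ~ has_finite_subcover (U n)) ->
    exists F : nat -> set (set X),
      (forall n, finite_set (F n) /\ F n `<=` U n) /\
      B (range (fun n => \bigcup_(V in F n) V)).

(* Only the restriction of [f] to [U] matters. *)
Definition finite_to_one_on (S T : Type) (U : set S) (f : S -> T) : Prop :=
  forall y : T, finite_set (U `&` f @^-1` [set y]).

Definition regular_family (X : topologicalType) (B : set (set (set X))) : Prop :=
  (forall U V : set (set X), B (U `|` V) -> B U \/ B V) /\
  (forall (U : set (set X)) (f : set X -> set X),
     B U ->
     finite_to_one_on U f ->
     (forall A, U A -> open (f A) /\ f A <> [set: X]) ->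
     (forall A, U A -> A `<=` f A) ->
     B (f @` U)).

Definition two_subsets (T : Type) (A : set T) : set (set T) :=
  [set P | P `<=` A /\ P #= `I_2].

(* A coloring of [D] is a total function; its values outside [D] are arbitrary. *)
Definition coloring (T : Type) (D : set T) (k : nat) (chi : T -> nat) : Prop :=
  forall x, D x -> (1 <= chi x <= k)%N.

Definition nonempty_finite (T : Type) (F : set T) : Prop :=
  F !=set0 /\ finite_set F.

Definition set_lt (F H : set nat) : Prop :=
  forall m n, F m -> H n -> (m < n)%N.

Definition disjoint_finite_selection (X : Type) (U F : nat -> set (set X)) : Prop :=
  (forall n, nonempty_finite (F n) /\ F n `<=` U n) /\ trivIset [set: nat] F.

Definition ramsey_selection (X : Type) (B : set (set (set X)))
    (chi1 : set X -> nat) (chi2 : set (set X) -> nat)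
    (V : nat -> set X) : Prop :=
  [/\ B (range V),
      forall F H : set nat, nonempty_finite F -> nonempty_finite H ->
        set_lt F H -> \bigcup_(n in F) V n <> \bigcup_(n in H) V n,
      exists c : nat, forall F : set nat, nonempty_finite F ->
        chi1 (\bigcup_(n in F) V n) = c
    & exists c : nat, forall F H : set nat,
        nonempty_finite F -> nonempty_finite H -> set_lt F H ->
        chi2 [set \bigcup_(n in F) V n; \bigcup_(n in H) V n] = c].

(* Main.v *)
Require Import Defs.
From mathcomp Require Import all_boot all_order.
From mathcomp Require Import all_classical topology.

Set Implicit Arguments.
Unset Strict Implicit.
Unset Printing Implicit Defensive.

Local Open Scope classical_set_scope.

(** Enumerate the first cover as [e 0, e 1, ...] and encode a finite subfamily
    by the list [s : seq nat] of its indices; the union [V s] of the subfamily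
    turns concatenation of lists into union of sets. The theorem is then a
    Milliken--Taylor theorem for the semigroup of lists in which the
    homogeneous sequence [s 0, s 1, ...] must moreover satisfy that
    [V (s 0), V (s 1), ...] is in [B].

    As in the Galvin--Glazer proof of Hindman's theorem, an idempotent
    ultrafilter [p] on the semigroup supplies homogeneous sequences with much
    freedom: [selection_game] shows that after each finite history [h] there
    is a set [A h] in [p] any element of which may be taken as the next term.
    The ultrafilter must be chosen so that [A h] contains good covers. Let
    [J j] be the set of indices [i >= j] of members of the [j]-th cover; its
    members still cover [X], by point-infiniteness. A set [A] of lists is
    [spread] if, for arbitrarily large [j], every finite subset of [J j] is
    contained in an element of [A] that is itself contained in [J j]. This
    notion is partition regular and passes to products of ultrafilters, so
    the Ellis--Numakura lemma, applied to the ultrafilters all of whose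
    members are spread, gives an idempotent of this kind
    ([spread_idempotent]). A spread set contains an increasing sequence of
    lists whose unions cover [X]. Being increasing matters: the union of
    finitely many terms is below a single term, so a finite choice from the
    cover amounts to the choice of one legal element of [A h].

    Thus every history offers an increasing open cover, and a branch of the
    resulting tree with large image is needed. Here [covering_game] uses the
    regularity of [B]. A single application of the selection hypothesis, to
    intersections of finitely many of the covers in the tree, gives a family
    [D 0, D 1, ...] in [B] such that [D n] lies below all sufficiently late
    moves at the first [n] histories. Cut the natural numbers into rapidly
    increasing intervals. By partition regularity, the [D n] with [n] in the
    even intervals, or those with [n] in the odd intervals, form a member of
    [B]. A branch can make one move for each of these intervals: the skipped
    interval leaves enough room for the history to be among the first [n] ones
    when the next interval starts. Mapping every [D n] to the move made for its
    interval is finite-to-one, and so the moves are in [B]. *)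

(** * Ultrafilters and the Ellis--Numakura lemma *)

Lemma filter_bigcap_finite (T : Type) (F : set_system T) (I : choiceType)
    (E : set I) (f : I -> set T) :
  Filter F -> finite_set E -> (forall i, E i -> F (f i)) ->
  F (\bigcap_(i in E) f i).
Proof.
move=> FF Efin EF; rewrite -(fset_setK Efin); apply: filter_bigI => i.
by rewrite in_fset_set // inE; exact: EF.
Qed.

Lemma ultra_setC (T : Type) (p : set_system T) (A : set T) :
  UltraFilter p -> p (~` A) <-> ~ p A.
Proof.
move=> pU; split=> [pnA pA|npA]; last by have [] := in_ultra_setVsetC A pU.
by apply: (@filter_not_empty _ p _); rewrite -(setICr A); exact: filterI.
Qed.

Lemma ultra_from_setC (T : Type) (F : set_system T) :
  ProperFilter F -> (forall A, F A \/ F (~` A)) -> UltraFilter F.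
Proof.
move=> FP FC; split=> // G GP FG; apply/seteqP; split=> // A GA.
have [//|FnA] := FC A.
by case: (@filter_not_empty _ G _); rewrite -(setICr A); apply: filterI => //;
   exact: FG.
Qed.

(** A filter is the intersection of the ultrafilters that extend it: if [A] is
    not in [F], the sets [C] with [A `|` C] in [F] form a proper
    filter that contains [F] and the complement of [A]. *)
Lemma filter_ultraE (T : Type) (F : set_system T) (A : set T) :
  ProperFilter F -> (forall p, UltraFilter p -> F `<=` p -> p A) -> F A.
Proof.
move=> FP Fp; apply: contrapT => nFA.
have GP : ProperFilter [set C | F (A `|` C)].
  split; first by rewrite /= setU0.
  split=> [|C D FC FD|C D CD]; rewrite /=.
  - by rewrite setUT; exact: filterT.
  - by rewrite setUIr; exact: filterI.
  - by move=> FC; apply: filterS FC; exact: setUS.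
have [p [pU Gp]] := ultraFilterLemma GP.
have pA : p A.
  by apply: Fp => // C FC; apply: Gp; apply: filterS FC => x; right.
suff: p (~` A) by move/(ultra_setC _ pU); apply.
by apply: Gp; rewrite /= setUv; exact: filterT.
Qed.

Lemma ultra_bounded_fiber (T : Type) (p : set_system T) (f : T -> nat) (k : nat) :
  UltraFilter p -> p [set x | f x <= k] -> exists c, p [set x | f x = c].
Proof.
move=> pU; elim: k => [|k IH] pk.
  by exists 0; apply: filterS pk => x /=; rewrite leqn0 => /eqP.
have [pe|pn] := in_ultra_setVsetC [set x | f x = k.+1] pU; first by exists k.+1.
apply: IH; apply: filterS (filterI pk pn) => x [/= + ne].
by rewrite leq_eqVlt => /orP[/eqP|].
Qed.

Section Ellis.
Context (S : Type) (op : S -> S -> S).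
Hypothesis opA : associative op.

(** The extension of [op] to filters; on ultrafilters it is the semigroup
    operation of the Stone--Cech compactification. *)
Definition fconv (F G : set_system S) : set_system S :=
  [set A | F [set x | G [set y | A (op x y)]]].

Lemma fconvA F G H : fconv (fconv F G) H = fconv F (fconv G H).
Proof.
apply/funext => A; rewrite /fconv /=; congr F; apply/funext => x.
congr G; apply/funext => y; congr H; apply/funext => z.
by rewrite /= opA.
Qed.

Lemma fconv_proper F G : ProperFilter F -> ProperFilter G ->
  ProperFilter (fconv F G).
Proof.
move=> FP GP; split.
  rewrite /fconv /= => FG; apply: (@filter_not_empty _ F _).
  by apply: filterS FG => x; exact: filter_not_empty.
rewrite /fconv; split=> [/=|A B /= FA FB|A B AB /=].
- by apply: filterS filterT => x _ /=; exact: filterT.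
- apply: filterS (filterI FA FB) => x [/= GA GB].
  exact: filterI GA GB.
- move=> FA; apply: filterS FA => x /= GA; apply: filterS GA => y; exact: AB.
Qed.

Lemma fconv_ultra p q : UltraFilter p -> UltraFilter q -> UltraFilter (fconv p q).
Proof.
move=> pU qU; apply: ultra_from_setC => [|A]; first exact: fconv_proper.
have [|pn] := in_ultra_setVsetC [set x | q [set y | A (op x y)]] pU.
  by left.
by right; apply: filterS pn => x /= /(ultra_setC _ qU).
Qed.

Lemma fconv_monol F G H : F `<=` G -> fconv F H `<=` fconv G H.
Proof. by move=> FG A /FG. Qed.

Lemma fconv_monor F G H : Filter F -> G `<=` H -> fconv F G `<=` fconv F H.
Proof. by rewrite /fconv => FF GH A /= FA; apply: filterS FA => x /GH. Qed.

(** Right translation by [p] maps the compact set of the ultrafilters that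
    extend [F] onto the set of those that extend [fconv F p]. *)
Lemma fconv_lift F p r : ProperFilter F -> UltraFilter p -> UltraFilter r ->
  fconv F p `<=` r -> exists q, [/\ UltraFilter q, F `<=` q & fconv q p = r].
Proof.
move=> FP pU rU Fpr.
pose R A := [set x | p [set y | A (op x y)]].
have GP : ProperFilter [set C | exists2 A, r A & F [set x | R A x -> C x]].
  split.
    move=> [A rA FA]; suff: r (~` A) by move/(ultra_setC _ rU); apply.
    apply: Fpr; rewrite /fconv /=; apply: filterS FA => x /= nRA.
    exact/(ultra_setC _ pU).
  split=> [|C D [A rA FA] [B rB FB]|C D CD [A rA FA]].
  - by exists setT; [exact: filterT|apply: filterS filterT => x].
  - exists (A `&` B); first exact: filterI.
    apply: filterS (filterI FA FB) => x [/= AC BD] pAB; split.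
      by apply: AC; apply: filterS pAB => y [].
    by apply: BD; apply: filterS pAB => y [].
  - by exists A => //; apply: filterS FA => x /= AC /AC /CD.
have [q [qU Gq]] := ultraFilterLemma GP.
exists q; split => //.
  move=> C FC; apply: Gq; exists setT; first exact: filterT.
  by apply: filterS FC => x ? _.
apply: (@max_filter _ _ rU).
  exact: fconv_proper.
move=> A rA; apply: Gq; exists A => //.
by apply: filterS filterT => x _.
Qed.

(** Filters stand for the closed sets of the ultrafilters extending them; this
    says that the closed set is a subsemigroup. *)
Definition semigroup_filter (F : set_system S) :=
  forall p q, UltraFilter p -> UltraFilter q -> F `<=` p -> F `<=` q ->
  F `<=` fconv p q.

(** A minimal nonempty closed subsemigroup, in terms of filters. *)
Lemma maximal_semigroup_filter F0 : ProperFilter F0 -> semigroup_filter F0 ->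
  exists F, [/\ ProperFilter F, F0 `<=` F, semigroup_filter F &
    forall G, ProperFilter G -> semigroup_filter G -> F `<=` G -> G = F].
Proof.
move=> F0P F0s.
pose good F := [/\ ProperFilter F, F0 `<=` F & semigroup_filter F].
(* The empty set of sets is allowed because the empty chain has it as union. *)
have [|F [FP Fmax]] := @Zorn_bigcup _ [set F | F = set0 \/ good F].
  move=> C Cgood Ctot.
  have [[X CX /set0P/eqP X0]|C0] := pselect (exists2 X, C X & X !=set0); last first.
    left; apply/seteqP; split=> // A [X CX XA].
    by apply: C0; exists X => //; exists A.
  right; have good_of Y A : C Y -> Y A -> good Y.
    by move=> CY YA; have [Y0|//] := Cgood _ CY; rewrite Y0 in YA.
  have [/X0 //|[XP F0X Xs]] := Cgood _ CX.
  split.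
  - split; first by move=> [Y CY Y0]; have [[]] := good_of _ _ CY Y0.
    split; first by exists X => //; exact: filterT.
      move=> A B [Y CY YA] [Z CZ ZB].
      have [YP _ _] := good_of _ _ CY YA; have [ZP _ _] := good_of _ _ CZ ZB.
      have [YZ|ZY] := Ctot _ _ CY CZ.
        by exists Z => //; apply: filterI => //; exact: YZ.
      by exists Y => //; apply: filterI => //; exact: ZY.
    move=> A B AB [Y CY YA]; have [YP _ _] := good_of _ _ CY YA.
    by exists Y => //; exact: filterS YA.
  - by move=> A /F0X XA; exists X.
  - move=> p q pU qU Cp Cq A [Y CY YA]; have [_ _ Ys] := good_of _ _ CY YA.
    by apply: Ys => // B YB; [apply: Cp|apply: Cq]; exists Y.
have [F0'|[FPr F0F Fs]] := FP.
  exfalso; apply: (Fmax F0); last by right; split.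
  rewrite F0'; split => // /(_ setT); apply; exact: filterT.
exists F; split=> // G GP Gs FG; apply: contrapT => nGF.
apply: (Fmax G); last by right; split=> //; exact: subset_trans FG.
by split => // GF; apply: nGF; apply/seteqP.
Qed.

(** Let [K] be a minimal closed subsemigroup and [p] in [K]. The left ideal
    [K p] is a closed subsemigroup of [K], hence equal to [K]; so the closed
    subsemigroup of those [q] in [K] with [q p = p] is nonempty, hence equal
    to [K], and it contains [p]. *)
Lemma idempotent_ultrafilter F0 : ProperFilter F0 -> semigroup_filter F0 ->
  exists p, [/\ UltraFilter p, F0 `<=` p & fconv p p = p].
Proof.
move=> F0P /(maximal_semigroup_filter F0P)[F [FP F0F Fs Fmax]].
have [p [pU Fp]] := ultraFilterLemma FP.
have FpE : fconv F p = F.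
  apply: Fmax; first exact: fconv_proper.
    move=> r r' rU r'U Fr Fr'.
    have [q [qU Fq qr]] := fconv_lift FP pU rU Fr.
    have [q' [q'U Fq' qr']] := fconv_lift FP pU r'U Fr'.
    rewrite -qr -qr' -fconvA; apply: fconv_monol; rewrite fconvA.
    have pq'U := fconv_ultra pU q'U.
    by apply: (Fs) => //; exact: Fs.
  move=> A FA; apply: (@filter_ultraE _ F) => q qU Fq; exact: (Fs) FA.
have [q [qU Fq qp]] : exists q, [/\ UltraFilter q, F `<=` q & fconv q p = p].
  by apply: fconv_lift => //; rewrite FpE.
(* [G] is the filter of the closed set of all [q'] in [K] with [q' p = p]. *)
pose G := [set A : set S | forall q', UltraFilter q' -> F `<=` q' ->
  p `<=` fconv q' p -> q' A].
have Gq : G `<=` q by move=> A; apply => //; rewrite qp.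
have GP : ProperFilter G.
  split; first by move/Gq; exact: filter_not_empty.
  split=> [q' *|A B GA GB q' *|A B AB GA q' *]; first exact: filterT.
    by apply: filterI; [exact: GA|exact: GB].
  by apply: filterS AB _; exact: GA.
have FG : F `<=` G by move=> A FA q' _ Fq' _; exact: Fq'.
have Gp q' : G `<=` q' -> p `<=` fconv q' p.
  by move=> Gq' A pA; apply: Gq' => q'' _ _; exact.
have GE : G = F.
  apply: Fmax => // q1 q2 q1U q2U Gq1 Gq2 A; apply; first exact: fconv_ultra.
    by apply: Fs => //; exact: subset_trans FG _.
  rewrite fconvA; apply: subset_trans (Gp _ Gq1) _.
  by apply: fconv_monor; exact: Gp.
exists p; split=> //; first exact: subset_trans Fp.
apply: (@max_filter _ _ pU); first exact: fconv_proper.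
by apply: Gp; rewrite GE.
Qed.

End Ellis.

(** * Homogeneous sequences from an idempotent ultrafilter *)

Section SelectionGame.
Context (T : choiceType) (p : set_system (seq T)).
Hypotheses (pF : Filter p) (p_idem : p `<=` fconv cat p p).
Context (A0 : set (seq T)) (D : seq T -> set (seq T)).
Hypotheses (pA0 : p A0) (pD : forall u, A0 u -> p (D u)).

(** A finite set of indices is given by a predicate on an interval, so that
    inductions can peel off a term at either end without sorting. *)
Definition select (s : nat -> seq T) (a : pred nat) (i n : nat) : seq T :=
  flatten [seq s j | j <- iota i n & a j].

Lemma selectS s a i n :
  select s a i n.+1 = (if a i then s i else [::]) ++ select s a i.+1 n.
Proof. by rewrite /select /=; case: (a i). Qed.

Lemma select0Sr s a n :
  select s a 0 n.+1 = select s a 0 n ++ (if a n then s n else [::]).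
Proof.
rewrite /select -addn1 iotaD /= filter_cat map_cat flatten_cat add0n.
by rewrite /=; case: (a n); rewrite /= !cats0.
Qed.

(* A state consists of all products of the terms chosen so far, and of the set
   in which all products of later terms must lie. *)
Let start : seq (seq T) * set (seq T) := ([:: [::]], A0).

Let refine (PC : seq (seq T) * set (seq T)) (s : seq T) :=
  ([seq u ++ s | u <- PC.1] ++ PC.1,
   PC.2 `&` [set t | PC.2 (s ++ t)] `&`
     [set t | forall u, u \in PC.1 -> D (u ++ s) t]).

Let admissible (PC : seq (seq T) * set (seq T)) :=
  p PC.2 /\ forall u t, u \in PC.1 -> PC.2 t -> A0 (u ++ t).

Let star (C : set (seq T)) := C `&` [set s | p [set t | C (s ++ t)]].

Let p_star C : p C -> p (star C).
Proof. by move=> pC; apply: filterI => //; exact: p_idem. Qed.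

Let admissible_start : admissible start.
Proof. by split=> // u t; rewrite mem_seq1 => /eqP ->. Qed.

Let admissible_refine PC s :
  admissible PC -> star PC.2 s -> admissible (refine PC s).
Proof.
case: PC => P C [/= pC PA] [Cs pCs]; split=> /=.
  apply: filterI; first exact: filterI.
  apply: (@filter_bigcap_finite _ _ _ [set` P] (fun u => D (u ++ s))).
    exact: finite_seq.
  by move=> u uP; apply: pD; exact: PA.
move=> u t + [[Ct Cst] _]; rewrite mem_cat => /orP[/mapP[v vP ->]|uP].
  by rewrite -catA; exact: PA.
exact: PA.
Qed.

Let state (h : seq (seq T)) := foldl refine start h.

(** The Galvin--Glazer argument as a game: with [D] as demands, any
    sequence that picks its next term [s n] in the set offered after
    [s 0, ..., s n.-1] has its products in [A0], and a product of later terms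
    meets the demand made by a product of earlier terms. The offered set
    consists of those [t] in the current constraint [C] for which the
    constraint [t^-1 C] is again in [p]; almost all [t] are such, since [p] is
    idempotent. *)
Lemma selection_game : exists A : seq (seq T) -> set (seq T),
  (forall h, p (A h)) /\
  forall s : nat -> seq T, (forall n, A (mkseq s n) (s n)) ->
  forall a : pred nat,
    (forall N, has a (iota 0 N) -> A0 (select s a 0 N)) /\
    (forall n N, a n -> has a (iota n.+1 N) ->
       D (select s a 0 n.+1) (select s a n.+1 N)).
Proof.
(* With the default value [setT] the offered set is in [p] also after histories
   that break the rules. *)
pose A h := if `[< p (state h).2 >] then star (state h).2 else setT.
exists A; split=> [h|s As a].
  rewrite /A; case: ifPn => [/asboolP /p_star //|_]; exact: filterT.
have stateS n : state (mkseq s n.+1) = refine (state (mkseq s n)) (s n).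
  by rewrite /state /mkseq -addn1 iotaD map_cat foldl_cat.
have adm n : admissible (state (mkseq s n)) /\ star (state (mkseq s n)).2 (s n).
  have star_of m : admissible (state (mkseq s m)) ->
      star (state (mkseq s m)).2 (s m).
    by move=> [pC _]; have := As m; rewrite /A asboolT.
  suff: admissible (state (mkseq s n)) by split=> //; exact: star_of.
  elim: n => [|n IH]; first exact: admissible_start.
  by rewrite stateS; apply: admissible_refine => //; exact: star_of.
(* A product lies in the constraint in force when its first term was chosen;
   peel off this first term. *)
have inC n i : has a (iota i n) -> (state (mkseq s i)).2 (select s a i n).
  elim: n i => [//|n IH] i.
  have [_ [Csi _]] := adm i; rewrite selectS /=.
  have [han _|hn] := boolP (has a (iota i.+1 n)).
    have := IH _ han; rewrite stateS => -[[/= C1 C2] _].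
    by case: (a i).
  case/orP => [ai|]; last by move/negP: hn.
  rewrite ai.
  suff -> : select s a i.+1 n = [::] by rewrite cats0.
  by move: hn; rewrite has_filter /select => /negPn/eqP ->.
have inP n : select s a 0 n \in (state (mkseq s n)).1.
  elim: n => [|n IH]; first by rewrite mem_head.
  rewrite stateS select0Sr mem_cat /=; case: (a n).
    by apply/orP; left; apply: map_f.
  by rewrite cats0 IH orbT.
split=> [N|n N an hN]; first exact: inC.
have := inC _ _ hN; rewrite stateS select0Sr an => -[_ /=]; apply.
exact: inP.
Qed.

End SelectionGame.

(** * An idempotent ultrafilter of spread sets *)

Section Spread.
Context (T : eqType) (J : nat -> set T).
Hypothesis J_decr : forall m n, (m <= n)%N -> J n `<=` J m.

Definition fills (j : nat) (A : set (seq T)) :=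
  forall K : seq T, (forall i, i \in K -> J j i) ->
  exists s, [/\ A s, forall i, i \in K -> i \in s & forall i, i \in s -> J j i].

Definition spread (A : set (seq T)) := forall n, exists2 j, (n <= j)%N & fills j A.

Lemma fillsS j A B : A `<=` B -> fills j A -> fills j B.
Proof. by move=> AB fA K /fA[s [/AB]]; exists s. Qed.

Lemma spreadS A B : A `<=` B -> spread A -> spread B.
Proof. by move=> AB sA n; have [j nj /(fillsS AB)] := sA n; exists j. Qed.

(** If [K] witnesses the failure for [A] and [L] that for [B], then [K ++ L]
    witnesses it for the union. *)
Lemma fillsU j A B : fills j (A `|` B) -> fills j A \/ fills j B.
Proof.
move=> fAB; have [|nA] := pselect (fills j A); first by left.
have [|nB] := pselect (fills j B); first by right.
move/existsNP: nA => [K /not_implyP[KJ nK]].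
move/existsNP: nB => [L /not_implyP[LJ nL]].
have [|s [ABs sKL sJ]] := fAB (K ++ L).
  by move=> i; rewrite mem_cat => /orP[/KJ|/LJ].
exfalso; case: ABs => [As|Bs].
  by apply: nK; exists s; split=> // i iK; apply: sKL; rewrite mem_cat iK.
by apply: nL; exists s; split=> // i iL; apply: sKL; rewrite mem_cat iL orbT.
Qed.

Lemma spreadU A B : spread (A `|` B) -> spread A \/ spread B.
Proof.
move=> sAB; have [|/existsNP[m nA]] := pselect (spread A); first by left.
right=> n; have [j mnj /fillsU[fA|fB]] := sAB (maxn m n).
  by case: nA; exists j => //; apply: leq_trans mnj; exact: leq_maxl.
by exists j => //; apply: leq_trans mnj; exact: leq_maxr.
Qed.

Let F0 : set_system (seq T) := [set A | ~ spread (~` A)].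

Let F0_proper : ProperFilter F0.
Proof.
split.
  rewrite /F0 /= setC0; apply; move=> n; exists n => // K KJ.
  by exists K.
split; rewrite /F0 /=.
- rewrite setCT => /(_ 0)[j _ /(_ [::])[//|s [[]]]].
- by move=> A B /= nA nB; rewrite setCI => /spreadU[].
- move=> A B AB /= nA sB; apply: nA; apply: spreadS sB; exact: subsetC.
Qed.

Let F0_spread p A : UltraFilter p -> F0 `<=` p -> p A -> spread A.
Proof.
move=> pU F0p pA; apply: contrapT => nA.
suff: p (~` A) by move/(ultra_setC _ pU); apply.
by apply: F0p; rewrite /F0 /= setCK.
Qed.

Let F0_semigroup : semigroup_filter cat F0.
Proof.
move=> p q pU qU F0p F0q A F0A; apply: contrapT.
move/(ultra_setC _ (fconv_ultra cat pU qU)) => pqA; apply: F0A => n.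
have [j nj fj] := F0_spread pU F0p pqA n; exists j => // K /fj.
move=> [s [/= /(F0_spread qU F0q)/(_ j)[j' jj' fj']] Ks sJ].
have [//|t [At _ tJ]] := fj' [::].
exists (s ++ t); split=> // i; rewrite mem_cat; first by move=> /Ks ->.
by case/orP=> [/sJ|/tJ /(J_decr jj')].
Qed.

(** Partition regularity says that the sets with non-spread complement form a
    filter [F0]; the ultrafilters that extend it are those all of whose members
    are spread. They form a subsemigroup: if [A] is in [p q], first find
    [s] with [K <= s <= J j] in the [p]-large set of left factors, and append a
    list [t <= J j' <= J j] with [s ++ t] in [A], which exists since
    the [t] with [s ++ t] in [A] form a [q]-large, hence spread, set. *)
Lemma spread_idempotent : exists p : set_system (seq T),
  [/\ UltraFilter p, fconv cat p p = p & forall A, p A -> spread A].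
Proof.
have [p [pU F0p pp]] := idempotent_ultrafilter (@catA T) F0_proper F0_semigroup.
by exists p; split=> // A; exact: F0_spread.
Qed.

End Spread.

(** * Increasing covers and the covering game *)

Lemma finite_nat_bound (E : set nat) : finite_set E ->
  exists N, forall n, E n -> (n < N)%N.
Proof.
move=> /finite_seqP[r ->]; exists (\max_(i <- r) i).+1 => n nr.
by rewrite ltnS; exact: (@leq_bigmax_seq _ r xpredT id n).
Qed.

Lemma open_bigcap_finite (X : topologicalType) (I : choiceType)
    (E : set I) (f : I -> set X) :
  finite_set E -> (forall i, E i -> open (f i)) -> open (\bigcap_(i in E) f i).
Proof.
move=> Efin fo; rewrite openE => x fx; apply: filter_bigcap_finite => // i Ei.
by apply: open_nbhs_nbhs; split; [exact: fo|exact: fx].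
Qed.

Section IncreasingCover.
Context (X : topologicalType) (R : nat -> set X).
Hypotheses (R_open : forall m, open (R m)) (R_mono : forall m, R m `<=` R m.+1).
Hypotheses (R_cover : forall x, exists m, R m x) (R_proper : forall m, R m <> setT).

Lemma increasing_mono m n : (m <= n)%N -> R m `<=` R n.
Proof.
apply: (@homo_leq _ R (fun A B => A `<=` B)); [exact: subset_refl| |exact: R_mono].
by move=> ? ? ?; exact: subset_trans.
Qed.

Lemma increasing_cover_countable : countable_open_covers X (range R).
Proof.
split; first exact: card_image_le.
split; first by move=> _ [m _ <-].
by apply/seteqP; split=> // x _; have [m Rx] := R_cover x; exists (R m).
Qed.

Lemma increasing_finite_union (G : set (set X)) : finite_set G ->
  G `<=` range R -> exists m, \bigcup_(V in G) V `<=` R m.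
Proof.
move=> Gfin GR.
have /choice[c cP] : forall V, exists m, G V -> R m = V.
  move=> V; have [/GR[m _ <-]|nGV] := pselect (G V); first by exists m.
  by exists 0.
have [N cN] := finite_nat_bound (finite_image c Gfin).
exists N => x [V GV Vx]; apply: (@increasing_mono (c V)).
  by apply/ltnW/cN; exists V.
by rewrite cP.
Qed.

Lemma increasing_no_finite_subcover : ~ has_finite_subcover (range R).
Proof.
move=> [G [/increasing_finite_union + /[swap]]] => + /[swap] => /[apply] -[m Gm].
move=> GX; apply: (R_proper (m := m)); apply/seteqP; split=> // x _.
by apply: Gm; rewrite -/(cover G id) GX.
Qed.

End IncreasingCover.

Section CoveringGame.
Context (X : topologicalType) (B : set (set (set X))).
Context (M : countType) (W : M -> set X) (O : seq M -> nat -> M).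
Hypotheses (B_regular : regular_family B)
           (B_Ufin : Ufin (countable_open_covers X) B).
Hypotheses (WO_open : forall h m, open (W (O h m)))
           (WO_mono : forall h m, W (O h m) `<=` W (O h m.+1))
           (WO_cover : forall h x, exists m, W (O h m) x)
           (WO_proper : forall h m, W (O h m) <> setT).

(** [O h m] is the [m]-th move offered after the history [h], and [W a] the open
    set contributed by the move [a]. *)
Definition is_play (s : nat -> M) := forall n, exists m, s n = O (mkseq s n) m.

Hypothesis play_inj : forall s, is_play s -> injective (W \o s).

(* Histories are ordered by their codes. The shift by [K] makes the empty history
   one of the first [n] for all [n], so that [C n m] is a proper subset of [X]. *)
Let K := pickle ([::] : seq M).

Let C n m := \bigcap_(h in [set h : seq M | (pickle h <= K + n)%N]) W (O h m).

Let C_finite n : finite_set [set h : seq M | (pickle h <= K + n)%N].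
Proof.
apply: (@finite_preimage _ _ [set q | (q <= K + n)%N] pickle).
  by move=> h h' _ _; apply: (pcan_inj pickleK).
by apply: sub_finite_set (finite_II (K + n).+1) => q.
Qed.

Let WO_le h m n : (m <= n)%N -> W (O h m) `<=` W (O h n).
Proof. exact: (@increasing_mono _ (fun m => W (O h m))). Qed.

Let C_open n m : open (C n m).
Proof. exact: open_bigcap_finite. Qed.

Let C_mono n m : C n m `<=` C n m.+1.
Proof. by move=> x Cx h hn; apply: WO_mono; exact: Cx. Qed.

Let C_cover n x : exists m, C n m x.
Proof.
have /choice[c cP] : forall h, exists m, W (O h m) x by move=> h.
have [N cN] := finite_nat_bound (finite_image c (C_finite n)).
exists N => h hn; apply: WO_le (cP h).
by apply/ltnW/cN; exists h.
Qed.

Let C_proper n m : C n m <> setT.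
Proof.
move=> CT; apply: (WO_proper (h := [::]) (m := m)); apply/seteqP; split=> // x _.
by have : C n m x; [rewrite CT|apply; rewrite /= leq_addr].
Qed.

Let selection : exists (D : nat -> set X) (g : nat -> nat),
  B (range D) /\ forall n h, (pickle h <= K + n)%N -> D n `<=` W (O h (g n)).
Proof.
have [||F [FC FB]] := B_Ufin (U := fun n => range (C n)).
- by move=> n; exact: increasing_cover_countable.
- by move=> n; exact: increasing_no_finite_subcover.
have /choice[g gP] : forall n, exists m, \bigcup_(V in F n) V `<=` C n m.
  move=> n; have [Ffin FnC] := FC n.
  exact: increasing_finite_union Ffin FnC.
exists (fun n => \bigcup_(V in F n) V), g; split=> // n h hn x /gP; exact.
Qed.

(** An inning drops out of [T] when each [D n] of its interval repeats a value
    [D m] that is attributed to another interval. *)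
Lemma covering_game : exists s T, is_play s /\ B ((W \o s) @` T).
Proof.
have [D [g [DB Dg]]] := selection.
pose G b := \max_(n < b.+1) g n.
have leG n b : (n <= b)%N -> (g n <= G b)%N.
  by rewrite -ltnS => nb; apply: (leq_bigmax (Ordinal nb)).
(* [nxt b] exceeds the code of each history obtained from one of code at most
   [K + b] by a move that lies above [D n] for all [n <= b]. *)
pose step b q := let h := odflt [::] (unpickle q) : seq M in
  pickle (rcons h (O h (G b))).
have stepE b h : step b (pickle h) = pickle (rcons h (O h (G b))).
  by rewrite /step pickleK.
pose nxt b := (b + \max_(q < (K + b).+1) step b q).+1.
have nxt_gt b : (b < nxt b)%N by rewrite ltnS leq_addr.
have nxt_pickle b h : (pickle h <= K + b)%N ->
    (pickle (rcons h (O h (G b))) <= nxt b)%N.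
  rewrite -ltnS -stepE => hb; apply/leqW/(leq_trans _ (leq_addl _ _)).
  exact: (@leq_bigmax _ (fun q : 'I_(K + b).+1 => step b q) (Ordinal hb)).
pose a j := iter j nxt 0.
have a_incr j : (a j < a j.+1)%N by exact: nxt_gt.
have a_ge j : (j <= a j)%N.
  by elim: j => // j IH; apply: leq_ltn_trans IH _.
have block n : exists j, (a j <= n < a j.+1)%N.
  have: exists j, (n < a j)%N by exists n.+1; exact: a_ge.
  move=> /ex_minnP[[//|j] nj minj]; exists j; rewrite nj andbT leqNgt.
  by apply/negP => /minj; rewrite ltnn.
pose I e := [set n | exists i, (a (e + i.*2) <= n < a (e + i.*2).+1)%N].
have [e EB] : exists e, B (D @` I e).
  suff /B_regular.1[] : B (D @` I 0 `|` D @` I 1); first by exists 0.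
    by exists 1.
  suff <- : range D = D @` I 0 `|` D @` I 1 by [].
  rewrite -image_setU; congr (_ @` _); apply/seteqP; split=> // n _.
  have [j] := block n; rewrite -(odd_double_half j).
  by case: (odd j) => nj; [right|left]; exists j./2.
(* The [i]-th move is made for the interval of index [e + i.*2]. *)
pose mv i := G (a (e + i.*2).+1).
pose hist i := iteri i (fun j h => rcons h (O h (mv j))) [::].
pose s i := O (hist i) (mv i).
have histE i : hist i = mkseq s i.
  by elim: i => // i IH; rewrite mkseqS -IH.
have s_play : is_play s by move=> i; exists (mv i); rewrite -histE.
have hist_pickle i : (pickle (hist i) <= K + a (e + i.*2))%N.
  elim: i => [|i IH]; first exact: leq_addr.
  rewrite doubleS !addnS; apply: (leq_trans _ (leq_addl K _)).
  apply: nxt_pickle; apply: leq_trans IH _.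
  by rewrite leq_add2l; exact: ltnW.
have Ds n i : (a (e + i.*2) <= n < a (e + i.*2).+1)%N -> D n `<=` W (s i).
  move=> /andP[an na]; apply: subset_trans (Dg n (hist i) _) _.
    by apply: leq_trans (hist_pickle i) _; rewrite leq_add2l.
  by apply: WO_le; apply: leG; exact: ltnW.
(* A set may equal [D n] for many [n]: [idx] fixes one interval for it. *)
have /choice[idx idxP] : forall A, exists i, (D @` I e) A ->
    exists2 n, (a (e + i.*2) <= n < a (e + i.*2).+1)%N & D n = A.
  move=> A; have [[n [i ni] <-]|nA] := pselect ((D @` I e) A).
    by exists i => _; exists n.
  by exists 0.
exists s, (idx @` (D @` I e)); split=> //.
rewrite (image_comp idx (W \o s)); apply: B_regular.2 => //.
- move=> y; have [[A [EA Ay]]|Ey] :=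
      pselect (exists A, (D @` I e `&` (W \o s \o idx) @^-1` [set y]) A).
    apply: sub_finite_set (finite_image D (finite_II (a (e + (idx A).*2).+1))).
    move=> A' [EA' A'y]; have [n /andP[_ na] <-] := idxP _ EA'.
    exists n => //=; suff <- : idx A' = idx A by [].
    by apply: (play_inj s_play); rewrite [LHS]A'y.
  by apply: (sub_finite_set _ (finite_set0 _)) => A EA; case: Ey; exists A.
- by move=> A _; split; [exact: WO_open|exact: WO_proper].
- by move=> A /idxP[n /Ds + DA]; rewrite DA.
Qed.

End CoveringGame.

(** * The selection theorem *)

Lemma infinite_nat_enum (E : set nat) : infinite_set E ->
  exists t : nat -> nat, {homo t : m n / (m < n)%N} /\ range t = E.
Proof.
move=> Einf.
have /choice[c cP] b : exists m,
    [/\ E m, (b <= m)%N & forall n, E n -> (b <= n)%N -> (m <= n)%N].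
  have : exists m, `[< E m >] && (b <= m)%N.
    apply: contrapT => nE; apply/Einf/(sub_finite_set _ (finite_II b)) => m Em /=.
    by rewrite ltnNge; apply/negP => bm; apply: nE; exists m; rewrite bm asboolT.
  move=> /ex_minnP[m /andP[/asboolP Em bm] minm]; exists m; split=> // n En bn.
  by apply: minm; rewrite bn asboolT.
pose t n := iter n (fun m => c m.+1) (c 0).
have t_lt n : (t n < t n.+1)%N by have [] := cP (t n).+1.
have t_ge n : (n <= t n)%N.
  by elim: n => // n IH; apply: leq_ltn_trans IH (t_lt n).
exists t; split; first by apply: homo_ltn => // ? ? ?; exact: ltn_trans.
apply/seteqP; split=> [_ [[|n] _ <-]|n En].
- by have [] := cP 0.
- by have [] := cP (t n).+1.
have : exists k, (n <= t k)%N by exists n.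
move=> /ex_minnP[k nk mink]; exists k => //; apply/eqP.
rewrite eqn_leq nk andbT; case: k nk mink => [|k] nk mink.
  by have [_ _] := cP 0; apply.
have [_ _] := cP (t k).+1; apply=> //; rewrite ltnNge; apply/negP => /mink.
by rewrite ltnn.
Qed.

Lemma card_set2 (T : Type) (a b : T) : a <> b -> ([set a; b] #= `I_2)%card.
Proof.
move=> ab; apply/eq_cardSP; exists a; first by left.
suff -> : [set a; b] `\ a = [set b] by exact: card_set1.
apply/seteqP; split=> [x [[]//]|x ->]; split; first by right.
by move=> ba; exact/ab.
Qed.

Lemma ramsey_subsequence (X : Type) (B : set (set (set X)))
    (chi1 : set X -> nat) (chi2 : set (set X) -> nat) (V : nat -> set X)
    (t : nat -> nat) :
  {homo t : m n / (m < n)%N} -> B (range (V \o t)) ->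
  (forall F H : set nat, nonempty_finite F -> nonempty_finite H ->
     set_lt F H -> \bigcup_(n in F) V n <> \bigcup_(n in H) V n) ->
  (exists c : nat, forall F : set nat, nonempty_finite F ->
     chi1 (\bigcup_(n in F) V n) = c) ->
  (exists c : nat, forall F H : set nat,
     nonempty_finite F -> nonempty_finite H -> set_lt F H ->
     chi2 [set \bigcup_(n in F) V n; \bigcup_(n in H) V n] = c) ->
  ramsey_selection B chi1 chi2 (V \o t).
Proof.
move=> t_incr BV distinct [c1 c1P] [c2 c2P].
have bigE F : \bigcup_(n in F) (V \o t) n = \bigcup_(n in t @` F) V n.
  by rewrite bigcup_image.
have imN F : nonempty_finite F -> nonempty_finite (t @` F).
  move=> [[n Fn] Ffin]; split; first by exists (t n), n.
  exact: finite_image.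
have imL F H : set_lt F H -> set_lt (t @` F) (t @` H).
  by move=> FH _ _ [m Fm <-] [n Hn <-]; apply/t_incr/FH.
split=> //.
- by move=> F H /imN FN /imN HN /imL; rewrite !bigE; exact: distinct.
- by exists c1 => F /imN; rewrite bigE; exact: c1P.
- by exists c2 => F H /imN FN /imN HN /imL; rewrite !bigE; exact: c2P.
Qed.

Section Selection.
Context (X : topologicalType) (B : set (set (set X))).
Hypotheses (B_covers : forall U, B U -> open_cover U)
  (B_regular : regular_family B) (B_Ufin : Ufin (countable_open_covers X) B).
Context (U : nat -> set (set X)).
Hypotheses (U_decr : forall n, U n.+1 `<=` U n)
  (U_cover : forall n, countable_open_covers X (U n))
  (U_ptinf : forall n, point_infinite (U n))
  (U_nofin : forall n, ~ has_finite_subcover (U n)).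
Context (k : nat) (chi1 : set X -> nat) (chi2 : set (set X) -> nat).
Hypotheses (chi1_col : coloring (@open X) k chi1)
  (chi2_col : coloring (two_subsets (@open X)) k chi2).
Context (e : nat -> set X).
Hypotheses (e_inj : injective e) (e_range : range e = U 0).

Let U_le m n : (m <= n)%N -> U n `<=` U m.
Proof.
apply: (@homo_leq _ U (fun A B => B `<=` A)); [exact: subset_refl| |exact: U_decr].
by move=> A C D CA DC; exact: subset_trans DC CA.
Qed.

Let V (s : seq nat) := \bigcup_(i in [set` s]) e i.

Let J j := [set i | (j <= i)%N /\ U j (e i)].

Let J_decr m n : (m <= n)%N -> J n `<=` J m.
Proof. by move=> mn i [ni Ui]; split; [exact: leq_trans ni|exact: U_le mn _ Ui]. Qed.

Let eU i : U 0 (e i). Proof. by rewrite -e_range; exists i. Qed.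

Let e_open i : open (e i). Proof. by have [_ [+ _]] := U_cover 0; apply. Qed.

Let V_open s : open (V s).
Proof. by apply: bigcup_open => i _. Qed.

Let V_proper s : V s <> setT.
Proof.
move=> VT; apply: (U_nofin (n := 0)); exists (e @` [set` s]); split.
- by apply: finite_image; exact: finite_seq.
- by move=> _ [i _ <-].
- by rewrite /is_cover /cover bigcup_image.
Qed.

Let V_sub s t : {subset s <= t} -> V s `<=` V t.
Proof. by move=> st x [i /st it ex]; exists i. Qed.

Let V_outside s : exists x, ~ V s x.
Proof.
by apply/existsNP => Vs; apply: (V_proper (s := s)); apply/seteqP; split.
Qed.

Let J_cover j x : exists2 i, J j i & e i x.
Proof.
apply: contrapT => nJ; apply: (U_ptinf (n := j) (x := x)).
apply: sub_finite_set (finite_image e (finite_II j)) => A [UA Ax].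
have [i _ eiA] : range e A by rewrite e_range; exact: U_le UA.
exists i => //=; rewrite ltnNge; apply/negP => ji.
by apply: nJ; exists i; rewrite ?eiA //; split=> //; rewrite eiA.
Qed.

(** The unions increase and cover [X]; they can start outside any given finite
    union [V v], because no finite union is [X] and each point has an index
    in [J j]. *)
Let fills_increasing_cover j A v : fills J j A ->
  exists s : nat -> seq nat,
    [/\ forall m, A (s m), forall m i, i \in s m -> J j i,
        forall m, V (s m) `<=` V (s m.+1), forall x, exists m, V (s m) x
      & forall m, ~ V (s m) `<=` V v].
Proof.
move=> fA; have [x0 vx0] := V_outside v; have [i0 Ji0 ex0] := J_cover j x0.
have /choice[F FP] : forall K : seq nat, exists s : seq nat,
    (forall i, i \in K -> J j i) ->
    [/\ A s, {subset K <= s} & forall i, i \in s -> J j i].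
  move=> K.
  have [/fA[s sP]|nK] := pselect (forall i, i \in K -> J j i); first by exists s.
  by exists [::].
pose L m := i0 :: [seq i <- iota 0 m | `[< J j i >]].
have LJ m i : i \in L m -> J j i.
  by rewrite inE mem_filter => /predU1P[->//|/andP[/asboolP]].
pose s m := iteri m (fun n r => F (r ++ L n)) (F (L 0)).
have sJ m i : i \in s m -> J j i.
  elim: m i => [|m IH] i; first by have [_ _] := FP _ (LJ 0); apply.
  have [|_ _] := FP (s m ++ L m); last by apply.
  by move=> {}i; rewrite mem_cat => /orP[/IH|/LJ].
have sLJ m i : i \in s m ++ L m -> J j i by rewrite mem_cat => /orP[/sJ|/LJ].
have s_sub m : {subset s m <= s m.+1}.
  by move=> i im; have [_ + _] := FP _ (sLJ m); apply; rewrite mem_cat im.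
have Ls m : {subset L m <= s m.+1}.
  by move=> i im; have [_ + _] := FP _ (sLJ m); apply; rewrite mem_cat im orbT.
exists s; split=> //.
- by case=> [|m]; [have [] := FP _ (LJ 0)|have [] := FP _ (sLJ m)].
- by move=> m; exact/V_sub/s_sub.
- move=> x; have [i Ji eix] := J_cover j x; exists i.+2, i => //.
  by apply: Ls; rewrite inE mem_filter asboolT // mem_iota /= ltnSn orbT.
- move=> m sv; apply/vx0/sv; exists i0 => //; case: m {sv} => [|m].
    by have [_ + _] := FP _ (LJ 0); apply; rewrite mem_head.
  by apply: Ls; rewrite mem_head.
Qed.

(** Besides the color [c1] of almost all [V s], each [s] has a color [col s] that
    the pair of [V s] and [V t] takes for almost all [t], and [c2] is the value
    of [col] at almost all [s]. The pair is genuine for almost all [t], because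
    the [t] with [V t] inside [V s] do not form a spread set. *)
Let colored_idempotent : exists (p : set_system (seq nat)) (c1 c2 : nat)
    (col : seq nat -> nat),
  [/\ UltraFilter p, fconv cat p p = p, forall A, p A -> spread J A,
      p [set s | chi1 (V s) = c1 /\ col s = c2]
    & forall s, p [set t | chi2 [set V s; V t] = col s]].
Proof.
have [p [pU pp pJ]] := spread_idempotent J_decr.
have [c1 c1P] : exists c, p [set s | chi1 (V s) = c].
  apply: (@ultra_bounded_fiber _ _ _ k); apply: filterS filterT => s _ /=.
  by have /andP[] := chi1_col (V_open s).
have pk s : p [set t | (chi2 [set V s; V t] <= k)%N].
  have : p [set t | ~ V t `<=` V s].
    have [//|/pJ /(_ 0)[j _ /(fills_increasing_cover s)]] :=
      in_ultra_setVsetC [set t | ~ V t `<=` V s] pU.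
    by move=> [r [/(_ 0) /= + _ _ _ /(_ 0)]].
  apply: filterS => t ts /=.
  suff /chi2_col/andP[] : two_subsets (@open X) [set V s; V t] by [].
  split; first by move=> _ [->|->].
  by apply: card_set2 => st; apply: ts; rewrite st.
have /choice[col colP] s : exists c, p [set t | chi2 [set V s; V t] = c].
  exact: ultra_bounded_fiber (pk s).
have [c2 c2P] : exists c, p [set s | col s = c].
  apply: (@ultra_bounded_fiber _ _ _ k); apply: filterS filterT => s _ /=.
  by have [t [/= <-]] := filter_ex (filterI (colP s) (pk s)).
by exists p, c1, c2, col; split=> //; exact: filterI.
Qed.

Let leq_sumn i (h : seq nat) : i \in h -> (i <= sumn h)%N.
Proof.
elim: h => //= j h IH; rewrite inE => /predU1P[->|/IH ih]; first exact: leq_addr.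
exact: leq_trans ih (leq_addl _ _).
Qed.

Let V_select (s : nat -> seq nat) (a : pred nat) (E : set nat) i n :
  (forall j, E j <-> (i <= j < i + n)%N && a j) ->
  V (select s a i n) = \bigcup_(j in E) V (s j).
Proof.
move=> EP; apply/seteqP; split=> x.
  move=> [m /flatten_mapP[j]]; rewrite mem_filter mem_iota andbC => /EP Ej mj mx.
  by exists j => //; exists m.
move=> [j /EP Ej [m mj mx]]; exists m => //; apply/flatten_mapP; exists j => //.
by rewrite mem_filter mem_iota andbC.
Qed.

(** The covering game is played with the moves that the selection game offers.
    The moves after a history [h] start beyond all indices in [h], belong to
    the cover of index [size h] or later, and contribute a point outside
    the union of [h]; these give the order, the membership and the
    distinctness requirements. All requirements survive the passage to the
    subsequence of the winning innings. *)
Lemma enumerated_selection : exists F : nat -> set (set X),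
  [/\ disjoint_finite_selection U F,
      ramsey_selection B chi1 chi2 (fun n => \bigcup_(A in F n) A)
    & forall m n, (m < n)%N -> set_lt (e @^-1` F m) (e @^-1` F n)].
Proof.
have [p [c1 [c2 [col [pU pp pJ pA0 pD]]]]] := colored_idempotent.
have [|u [_ <-]|A [pA Aprod]] :=
    @selection_game _ p _ _ _ (fun u => [set t | chi2 [set V u; V t] = c2]) pA0.
- by rewrite pp.
- exact: pD.
have /choice[O OP] h : exists s : nat -> seq nat,
    [/\ forall m, A h (s m),
        forall m i, i \in s m -> J (size h + (sumn (flatten h)).+1) i,
        forall m, V (s m) `<=` V (s m.+1), forall x, exists m, V (s m) x
      & forall m, ~ V (s m) `<=` V (flatten h)].
  have [j hj /(fills_increasing_cover (flatten h))[s [sA sJ ? ? ?]]] :=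
    pJ _ (pA h) (size h + (sumn (flatten h)).+1).
  by exists s; split=> // m i /sJ; exact: J_decr.
have play_new s : is_play O s -> forall i j, (i < j)%N -> V (s i) <> V (s j).
  move=> sP i j ij Vij; have [m sj] := sP j; have [_ _ _ _ /(_ m)] := OP (mkseq s j).
  rewrite -sj -Vij; apply; apply: V_sub => x xi; apply/flattenP.
  by exists (s i) => //; apply: map_f; rewrite mem_iota.
have play_inj s : is_play O s -> injective (V \o s).
  move=> sP i j Vij; have [ij|ji|//] := ltngtP i j.
    by case: (play_new _ sP _ _ ij).
  by case: (play_new _ sP _ _ ji).
have [|||||s [T [s_play BT]]] := @covering_game X B _ V O B_regular B_Ufin.
- by move=> h m; exact: V_open.
- by move=> h; have [] := OP h.
- by move=> h; have [] := OP h.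
- by move=> h m; exact: V_proper.
- exact: play_inj.
have s_prop i : [/\ A (mkseq s i) (s i), forall x, x \in s i -> U i (e x),
    forall j x y, (j < i)%N -> x \in s j -> y \in s i -> (x < y)%N
  & ~ V (s i) `<=` V (flatten (mkseq s i))].
  have [m sm] := s_play i; have [OA OJ _ _ ON] := OP (mkseq s i).
  rewrite size_mkseq in OJ; rewrite sm; split=> //.
    by move=> x /OJ[_]; apply: U_le; exact: leq_addr.
  move=> j x y ji xj /OJ[+ _]; apply: leq_trans; apply: leq_trans (leq_addl _ _).
  rewrite ltnS; apply: leq_sumn; apply/flattenP; exists (s j) => //.
  by apply: map_f; rewrite mem_iota.
have s_neq0 i : exists x, x \in s i.
  apply: contrapT => ns; have [_ _ _] := s_prop i; apply=> x [y ys].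
  by case: ns; exists y.
(* A finite set of innings would make finitely many [e i] cover [X]. *)
have Tinf : infinite_set T.
  move=> Tfin; have [_ BX] := B_covers BT.
  have [N TN] := finite_nat_bound Tfin.
  apply: (V_proper (s := flatten (mkseq s N))); apply/seteqP; split=> // x _.
  have : cover ((V \o s) @` T) id x by rewrite BX.
  move=> [_ [i Ti <-]]; apply: V_sub => y yi; apply/flattenP.
  by exists (s i) => //; apply: map_f; rewrite mem_iota TN.
have [t [t_incr tT]] := infinite_nat_enum Tinf.
have t_ge n : (n <= t n)%N.
  by elim: n => // n IH; apply: leq_ltn_trans IH _; exact: t_incr.
pose F n := e @` [set` s (t n)].
have FE n : \bigcup_(A in F n) A = V (s (t n)) by rewrite bigcup_image.
have eF n i : F n (e i) -> i \in s (t n) by move=> [j sj /e_inj <-].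
have F_lt m n : (m < n)%N -> set_lt (e @^-1` F m) (e @^-1` F n).
  move=> mn x y /eF xm /eF yn; have [_ _ + _] := s_prop (t n).
  by move=> /(_ _ _ _ (t_incr _ _ mn) xm yn).
have maxP E : nonempty_finite E -> exists n, E n /\
    forall i, E i -> (i < n.+1)%N.
  move=> [[i Ei] /finite_nat_bound[N EN]].
  have : exists n, `[< E n >] by exists i; exact/asboolP.
  have EN' n : `[< E n >] -> (n <= N)%N by move/asboolP/EN/ltnW.
  move=> /(ex_maxnP)/(_ EN')[n /asboolP En maxn]; exists n; split=> // j Ej.
  by rewrite ltnS; apply: maxn; exact/asboolP.
exists F; split=> //.
  split=> [n|m n _ _ [Y [[i im <-] Fni]]].
    split; first split.
    - by have [i si] := s_neq0 (t n); exists (e i), i.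
    - by apply: finite_image; exact: finite_seq.
    - move=> _ [i si <-]; have [_ + _ _] := s_prop (t n).
      by move=> /(_ _ si); apply: U_le.
  have Fmi : F m (e i) by exists i.
  by have [mn|nm|//] := ltngtP m n; [have := F_lt _ _ mn i i Fmi Fni|
    have := F_lt _ _ nm i i Fni Fmi]; rewrite ltnn.
have -> : (fun n => \bigcup_(A in F n) A) = (V \o s) \o t.
  by apply/funext => n; rewrite FE.
have s_move n : A (mkseq s n) (s n) by have [] := s_prop n.
apply: ramsey_subsequence => //.
- by move: BT; rewrite -tT image_comp.
- move=> E H _ [[n Hn] _] EH EHV; have [_ _ _] := s_prop n; apply.
  have : V (s n) `<=` \bigcup_(n in H) (V \o s) n by move=> x; exists n.
  rewrite -EHV => /subset_trans; apply=> x [i Ei]; apply: V_sub => y yi.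
  by apply/flattenP; exists (s i) => //; apply: map_f; rewrite mem_iota EH.
- exists c1 => E /maxP[n [En Elt]].
  have hasE : has (fun j => `[< E j >]) (iota 0 n.+1).
    by apply/hasP; exists n; [rewrite mem_iota /= add0n ltnSn|exact/asboolP].
  have [/(_ n.+1 hasE) [+ _] _] := Aprod s s_move (fun j => `[< E j >]).
  rewrite (@V_select s _ E) // => j.
  by split=> [Ej|/andP[_ /asboolP//]]; rewrite Elt //=; exact/asboolP.
- exists c2 => E H /maxP[n [En Elt]] /maxP[m [Hm Hlt]] EH.
  (* One predicate [a] selects [E] below [n.+1] and [H] from there on. *)
  pose a j := `[< E j \/ H j >].
  have an : a n by apply/asboolP; left.
  have hasH : has a (iota n.+1 m).
    apply/hasP; exists m; last by apply/asboolP; right.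
    by rewrite mem_iota (EH _ _ En Hm) addSn ltnS leq_addl.
  have [_ /(_ n m an hasH)] := Aprod s s_move a.
  rewrite /mkset (@V_select s _ E) => [|j]; last first.
    split=> [Ej|/andP[jn /asboolP[//|Hj]]].
      by rewrite Elt //=; apply/asboolP; left.
    by have := EH _ _ En Hj; rewrite ltnNge -ltnS; case/negP.
  rewrite (@V_select s _ H) // => j.
  split=> [Hj|/andP[/andP[nj _] /asboolP[Ej|//]]]; last first.
    by have := Elt _ Ej; rewrite ltnNge nj.
  rewrite (EH _ _ En Hj) /=; apply/andP; split; last by apply/asboolP; right.
  by apply: leq_trans (Hlt _ Hj) _; rewrite addSn ltnS leq_addl.
Qed.


End Selection.

Theorem theorem5p6 (X : topologicalType) (B : set (set (set X)))
    (B_covers : forall U, B U -> open_cover U)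
    (B_regular : regular_family B)
    (B_Ufin : Ufin (countable_open_covers X) B)
    (U : nat -> set (set X))
    (U_decr : forall n, U n.+1 `<=` U n)
    (U_cover : forall n, countable_open_covers X (U n))
    (U_ptinf : forall n, point_infinite (U n))
    (U_nofin : forall n, ~ has_finite_subcover (U n))
    (k : nat) (chi1 : set X -> nat) (chi2 : set (set X) -> nat)
    (chi1_col : coloring (@open X) k chi1)
    (chi2_col : coloring (two_subsets (@open X)) k chi2) :
  (exists F : nat -> set (set X),
     disjoint_finite_selection U F /\
     ramsey_selection B chi1 chi2 (fun n => \bigcup_(A in F n) A)) /\
  (forall e : nat -> set X, injective e -> range e = U 0 ->
   exists F : nat -> set (set X),
     [/\ disjoint_finite_selection U F,
         ramsey_selection B chi1 chi2 (fun n => \bigcup_(A in F n) A)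
       & forall m n, (m < n)%N -> set_lt (e @^-1` F m) (e @^-1` F n)]).
Proof.
have main := enumerated_selection B_covers B_regular B_Ufin U_decr U_cover
  U_ptinf U_nofin chi1_col chi2_col.
split; last exact: main.
have [U0_count [_ U0_cover]] := U_cover 0.
have U0_inf : infinite_set (U 0).
  by move=> U0_fin; apply: (U_nofin 0); exists (U 0); split => // A.
have := eq_card_nat U0_count U0_inf; rewrite card_eq_sym => /card_set_bijP.
move=> [e [eU e_inj e_surj]].
have [||F [FU FR _]] := main e; last by exists F.
  by move=> i j; apply: e_inj; rewrite in_setT.
apply/seteqP; split=> [_ [i _ <-]|A /e_surj//]; exact: eU.
Qed.
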